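(* Let $\mu\in\mathbb{R}$ with $\mu\neq -n-\tfrac12$ for all integers $n\ge 0$ and $\mu\neq\tfrac12$. Let $\{P_n\}_{n\ge0}$ be a symmetric monic orthogonal polynomial sequence satisfying $$P_{n+2}(x)=xP_{n+1}(x)-\gamma_{n+1}P_n(x),\ n\ge0,\qquad P_0(x)=1,\ P_1(x)=x,$$ with $\gamma_{n+1}\ne0$ for all $n\ge0$. Then $\{P_n\}_{n\ge0}$ is $T_\mu$-classical if and only if there is a solution $(\theta_n)_{n\ge1}$ (of nonzero complex numbers) of the Riccati equation $$\xi_{n+1}\theta_{n+1}+\xi_n\theta_n^{-1}=2,\qquad n\ge1,$$ such that, with the conventions $\theta_0=1$ and $\theta_{-1}=0$, each polynomial $P_n$, $n\ge 0$, satisfies the differential-difference equation $$(a_nx^2-b_n)\,T_\mu^2P_n-c_n\,x\,T_\mu P_n-d_nP_n=0,$$ where $$a_n=\theta_{n-1}-1,$$ $$b_n=(\mu_{n+1}\theta_{n-1}-\mu_n)(\mu_{n-1}\theta_{n-1}-\mu_{n-2})\,\frac{\gamma_n}{\xi_n\mu_n},$$ $$c_n=\mu_{n-2}\theta_{n-1}-\mu_{n-1},$$ $$d_n=\xi_n\mu_n\theta_{n-1}.$$ (For $n=0$ the value of $b_0$ is irrelevant, since $T_\mu^2P_0=0$; take $b_0=0$.)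
   Context: Polynomials are in one variable with complex coefficients. The Dunkl operator is $(T_\mu f)(x)=f'(x)+\mu\,\dfrac{f(x)-f(-x)}{x}$, and $T_\mu^2=T_\mu\circ T_\mu$. For every integer $n$ (including negative $n$) put $\mu_n=n+\mu\,(1-(-1)^n)$ and $\xi_n=1+2\mu(-1)^n$; thus $T_\mu x^n=\mu_nx^{n-1}$ for $n\ge0$. A sequence $\{P_n\}_{n\ge0}$ of monic polynomials with $\deg P_n=n$ is a monic orthogonal polynomial sequence (MOPS) if there is a linear functional $u$ on $\mathbb{C}[x]$ with $\langle u,P_nP_m\rangle=0$ for $n\ne m$ and $\langle u,P_n^2\rangle\ne0$ for all $n$ (positive definiteness is not required). It is symmetric if $P_n(-x)=(-1)^nP_n(x)$ for all $n\ge0$. A MOPS $\{P_n\}_{n\ge0}$ is called $T_\mu$-classical (Dunkl-classical) if the sequence $\{Q_n\}_{n\ge0}$ with $Q_n(x)=\mu_{n+1}^{-1}(T_\mu P_{n+1})(x)$ is also a MOPS. *)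

(* Defs.v *)
From HB Require Import structures.
From mathcomp Require Import all_boot all_order all_algebra.
From mathcomp Require Import reals complex.

Set Implicit Arguments.
Unset Strict Implicit.
Unset Printing Implicit Defensive.

Import Order.TTheory GRing.Theory Num.Theory.
Local Open Scope ring_scope.

(* The division by 'X is exact (dunkl_divXK), so [dunkl mu f] is the polynomial
   f'(x) + mu (f(x) - f(-x)) / x. *)
(* Pitfall: "\Po" has the precedence of subtraction, hence the parentheses. *)
Definition dunkl (F : fieldType) (mu : F) (f : {poly F}) : {poly F} :=
  f^`() + mu *: ((f - (f \Po (- 'X))) %/ 'X).

Lemma dunkl_divXK (F : fieldType) (f : {poly F}) :
  (f - (f \Po (- 'X))) %/ 'X * 'X = f - (f \Po (- 'X)).
Proof.
have dvdX (p : {poly F}) : ('X %| p) = (p.[0] == 0).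
  by rewrite -[_ == 0]/(root p 0) -dvdp_XsubCl polyC0 subr0.
apply: divpK; rewrite dvdX.
by rewrite hornerD hornerN horner_comp hornerN hornerX oppr0 subrr.
Qed.

Definition dunkl_mu (F : fieldType) (mu : F) (n : int) : F :=
  n%:~R + mu * (1 - (-1) ^ n).

Definition dunkl_xi (F : fieldType) (mu : F) (n : int) : F :=
  1 + 2 * mu * (-1) ^ n.

Definition is_MOPS (F : fieldType) (P : nat -> {poly F}) : Prop :=
  (forall n, P n \is monic /\ size (P n) = n.+1) /\
  exists u : {scalar {poly F}},
    (forall n m, n <> m -> u (P n * P m) = 0) /\
    (forall n, u (P n ^+ 2) <> 0).

Definition symmetric_seq (F : fieldType) (P : nat -> {poly F}) : Prop :=
  forall n, (P n \Po (- 'X)) = (-1) ^+ n *: P n.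

Definition dunkl_deriv_seq (F : fieldType) (mu : F) (P : nat -> {poly F})
    (n : nat) : {poly F} :=
  (dunkl_mu mu n.+1)^-1 *: dunkl mu (P n.+1).

Definition dunkl_classical (F : fieldType) (mu : F) (P : nat -> {poly F}) :
    Prop :=
  is_MOPS P /\ is_MOPS (dunkl_deriv_seq mu P).

(* The family theta is indexed by int so that theta_{-1} and theta_0 make sense;
   its values below -1 are never used. *)
Definition riccati (F : fieldType) (mu : F) (theta : int -> F) : Prop :=
  forall n : nat, (1 <= n)%N ->
    dunkl_xi mu n.+1 * theta n.+1 + dunkl_xi mu n * (theta n)^-1 = 2.

Definition coef_a (F : fieldType) (theta : int -> F) (n : nat) : F :=
  theta (n%:Z - 1) - 1.

Definition coef_b (F : fieldType) (mu : F) (gamma : nat -> F)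
    (theta : int -> F) (n : nat) : F :=
  if n == 0%N then 0 else
  (dunkl_mu mu (n%:Z + 1) * theta (n%:Z - 1) - dunkl_mu mu n)
  * (dunkl_mu mu (n%:Z - 1) * theta (n%:Z - 1) - dunkl_mu mu (n%:Z - 2))
  * (gamma n / (dunkl_xi mu n * dunkl_mu mu n)).

Definition coef_c (F : fieldType) (mu : F) (theta : int -> F) (n : nat) : F :=
  dunkl_mu mu (n%:Z - 2) * theta (n%:Z - 1) - dunkl_mu mu (n%:Z - 1).

Definition coef_d (F : fieldType) (mu : F) (theta : int -> F) (n : nat) : F :=
  dunkl_xi mu n * dunkl_mu mu n * theta (n%:Z - 1).

(* Main.v *)
Require Import Defs.
From HB Require Import structures.
From mathcomp Require Import all_boot all_order all_algebra.
From mathcomp Require Import reals complex.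
From mathcomp Require Import ring lra.

Set Implicit Arguments.
Unset Strict Implicit.
Unset Printing Implicit Defensive.

Import Order.TTheory GRing.Theory Num.Theory.
Local Open Scope ring_scope.
Local Open Scope complex_scope.

(** Write T for the Dunkl operator, mu_n and xi_n for [dunkl_mu] and [dunkl_xi],
    and Q_n = T P_{n+1} / mu_{n+1}.

    On a polynomial of the parity of n, the operator obeys the product rule
    T (x f) = x T f + xi_n f. Applied to the recurrence of P, it shows that if Q
    satisfies a symmetric three-term recurrence with coefficients g_n, then
    P_{n+1} = Q_{n+1} + s_n Q_{n-1} for s_n determined by gamma and g, and that
    conversely a sequence so connected to P is Q (dunkl_deriv_connection). Such
    a connection is in turn equivalent to two scalar relations between gamma, g
    and s, obtained by writing the recurrence of P in the basis Q
    (connection_ttr). With theta_n = mu_{n+1} g_n / (mu_n gamma_{n+1}), the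
    multiplicative relation is the Riccati equation (theta_conn_riccati); the
    additive one, s_{n+1} = g_{n+1} + s_n - gamma_{n+1}, is a recurrence for
    gamma. Being a MOPS is replaced everywhere by satisfying a recurrence with
    nonzero coefficients, by Favard's theorem and its converse.

    If P is classical, the connection P_{n+2} = x Q_{n+1} + e Q_n, its image by
    T, and a lowering relation that follows from the Riccati equation are three
    relations among P_{n+2}, Q_{n+1}, Q_n, T Q_{n+1} and T Q_n.  Eliminating Q_n
    and T Q_n leaves the differential-difference equation
    (dunkl_equation_forward).

    Conversely, it is enough to compare the coefficients of x^n in the equation
    of P_{n+2}. One side is the subleading coefficient of P_{n+2}, that is
    -(gamma_1 + ... + gamma_{n+1}), times a factor mu_{n+1} theta_{n+1} - mu_n
    that also divides the other side. This factor does not vanish, because the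
    Riccati equation would otherwise drive theta to zero (riccati_descent). So
    the partial sums of gamma are known in terms of theta
    (dunkl_equation_subleading), and subtracting two consecutive ones gives the
    additive relation (theta_conn_rec). Hence the polynomials generated by the
    coefficients g_n are the Q_n, and Favard's theorem applies to them. *)

(** * The numbers mu_n and xi_n *)

Section DunklNumbers.
Variables (F : fieldType) (mu : F).
Implicit Types n : int.

Lemma dunkl_xiS n : dunkl_xi mu (n + 1) = 2 - dunkl_xi mu n.
Proof. by rewrite /dunkl_xi expfzDr ?oppr_eq0 ?oner_eq0 // expr1z; ring. Qed.

Lemma dunkl_muS n : dunkl_mu mu (n + 1) = dunkl_mu mu n + dunkl_xi mu n.
Proof.
rewrite /dunkl_mu /dunkl_xi expfzDr ?oppr_eq0 ?oner_eq0 // expr1z.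
by rewrite intrD; ring.
Qed.

Lemma dunkl_xi_pred n : dunkl_xi mu (n - 1) = 2 - dunkl_xi mu n.
Proof. by have := dunkl_xiS (n - 1); rewrite subrK => ->; ring. Qed.

Lemma dunkl_mu_pred n :
  dunkl_mu mu (n - 1) = dunkl_mu mu n - 2 + dunkl_xi mu n.
Proof.
by have := dunkl_muS (n - 1); rewrite subrK dunkl_xi_pred => ->; ring.
Qed.

Lemma dunkl_muSn (n : nat) :
  dunkl_mu mu n.+1 = dunkl_mu mu n + dunkl_xi mu n.
Proof. by rewrite -addn1 PoszD dunkl_muS. Qed.

Lemma dunkl_xiSn (n : nat) : dunkl_xi mu n.+1 = 2 - dunkl_xi mu n.
Proof. by rewrite -addn1 PoszD dunkl_xiS. Qed.

Lemma dunkl_mu0 : dunkl_mu mu 0 = 0.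
Proof. by rewrite /dunkl_mu expr0z; ring. Qed.

Lemma dunkl_mu1 : dunkl_mu mu 1 = dunkl_xi mu 0.
Proof. by rewrite -[1]add0r dunkl_muS dunkl_mu0 add0r. Qed.

Lemma dunkl_mu2 : dunkl_mu mu 2 = 2.
Proof. by rewrite /dunkl_mu -[(-1) ^ 2]/((-1) * (-1)); ring. Qed.

Lemma dunkl_xi_odd (n : nat) : dunkl_xi mu n = dunkl_xi mu (odd n).
Proof. by rewrite /dunkl_xi -!exprnP signr_odd. Qed.

End DunklNumbers.

(** * The Dunkl operator on symmetric polynomials *)

Section DunklOperator.
Variables (F : fieldType) (mu : F).
Implicit Types (p q : {poly F}) (n i : nat).

Lemma coef_comp_oppX p i : (p \Po (- 'X))`_i = (-1) ^+ i * p`_i.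
Proof.
elim/poly_ind: p i => [|p c IHp] i; first by rewrite comp_poly0 coef0 mulr0.
rewrite comp_polyD comp_polyM comp_polyX comp_polyC mulrN !coefD coefN !coefMX.
case: i => [|i]; first by rewrite expr0 oppr0 mul1r.
by rewrite /= IHp coefC /= !addr0 exprS mulN1r mulNr.
Qed.

(** The operator shifts coefficients and rescales them, so that identities
    between polynomials reduce to identities between the numbers mu_n. *)
Lemma coef_dunkl p i : (dunkl mu p)`_i = dunkl_mu mu i.+1 * p`_i.+1.
Proof.
rewrite /dunkl coefD coefZ coef_deriv.
have := congr1 (fun q : {poly F} => q`_i.+1) (dunkl_divXK p).
rewrite /= coefMX /= => ->.
rewrite coefB coef_comp_oppX /dunkl_mu -exprnP -pmulrn -mulr_natl; ring.
Qed.

Lemma coef_XMdunkl p i : ('X * dunkl mu p)`_i = dunkl_mu mu i * p`_i.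
Proof.
by case: i => [|i]; rewrite coefXM /= ?dunkl_mu0 ?mul0r // coef_dunkl.
Qed.

Lemma coef_XXMdunkl2 p i :
  ('X^2 * dunkl mu (dunkl mu p))`_i =
  dunkl_mu mu (i%:Z - 1) * dunkl_mu mu i * p`_i.
Proof.
rewrite expr2 -mulrA coefXM; case: i => [|i].
  by rewrite dunkl_mu0 mulr0 mul0r.
by rewrite /= coef_XMdunkl coef_dunkl -[i.+1]addn1 PoszD addrK mulrA.
Qed.

Lemma dunklD p q : dunkl mu (p + q) = dunkl mu p + dunkl mu q.
Proof. by apply/polyP=> i; rewrite !(coef_dunkl, coefD) mulrDr. Qed.

Lemma dunklZ c p : dunkl mu (c *: p) = c *: dunkl mu p.
Proof. by apply/polyP=> i; rewrite !(coef_dunkl, coefZ) mulrCA. Qed.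

Lemma dunklB p q : dunkl mu (p - q) = dunkl mu p - dunkl mu q.
Proof. by rewrite -scaleN1r dunklD dunklZ scaleN1r. Qed.

Lemma dunklC c : dunkl mu c%:P = 0.
Proof. by apply/polyP=> i; rewrite coef_dunkl coefC mulr0 coef0. Qed.

Lemma dunklX : dunkl mu 'X = (dunkl_mu mu 1)%:P.
Proof.
by apply/polyP=> -[|i]; rewrite coef_dunkl coefX coefC ?mulr1 ?mulr0.
Qed.

(** In the wrong parity, the symmetry equates p`_i with its opposite. *)
Lemma coef_symmetric p n i : 2 != 0 :> F -> p \Po (- 'X) = (-1) ^+ n *: p ->
  odd i != odd n -> p`_i = 0.
Proof.
move=> two_neq0 /(congr1 (fun q : {poly F} => q`_i)).
rewrite coef_comp_oppX coefZ -[(-1) ^+ i]signr_odd -[(-1) ^+ n]signr_odd.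
case: (odd i) (odd n) => [] [] // e _; apply/eqP;
  rewrite -(mulrI_eq0 _ (mulfI two_neq0)).
  by rewrite mulr_natl mulr2n -{1}[p`_i]mul1r -e mulN1r addNr.
by rewrite mulr_natl mulr2n -{1}[p`_i]mul1r e mulN1r addNr.
Qed.

Lemma dunkl_symmetric p n : p \Po (- 'X) = (-1) ^+ n.+1 *: p ->
  dunkl mu p \Po (- 'X) = (-1) ^+ n *: dunkl mu p.
Proof.
move=> /polyP psym; apply/polyP=> i.
have := psym i.+1; rewrite !(coef_comp_oppX, coefZ) coef_dunkl.
rewrite !exprS !mulN1r !mulNr.
by move/oppr_inj => e; rewrite mulrCA e mulrCA.
Qed.

(** Multiplication by x raises each exponent by one, and
    mu_{i+1} - mu_i = xi_i depends on the parity of i only, which is that of n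
    wherever p has a nonzero coefficient. *)
Lemma dunkl_mulX p n : 2 != 0 :> F -> p \Po (- 'X) = (-1) ^+ n *: p ->
  dunkl mu ('X * p) = 'X * dunkl mu p + dunkl_xi mu n *: p.
Proof.
move=> two_neq0 psym; apply/polyP=> i.
rewrite coef_dunkl coefD coef_XMdunkl coefXM coefZ /= dunkl_muSn mulrDl.
congr (_ + _); have [e|ne] := eqVneq (odd i) (odd n).
  by rewrite dunkl_xi_odd e -dunkl_xi_odd.
by rewrite (coef_symmetric two_neq0 psym ne) !mulr0.
Qed.

End DunklOperator.

(** * Symmetric orthogonal polynomials and three-term recurrences *)

Definition symmetric_ttr (F : fieldType) (g : nat -> F) (P : nat -> {poly F}) :
    Prop :=
  [/\ P 0%N = 1, P 1%N = 'X
    & forall n, P n.+2 = 'X * P n.+1 - g n.+1 *: P n].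

Fixpoint symop (F : fieldType) (g : nat -> F) (n : nat) : {poly F} :=
  match n with
  | 0%N => 1
  | m.+1 => if m is k.+1 then 'X * symop g m - g m *: symop g k else 'X
  end.

Lemma symop_ttr (F : fieldType) (g : nat -> F) : symmetric_ttr g (symop g).
Proof. by []. Qed.

Lemma nat_ind2 (A : nat -> Prop) :
  A 0%N -> A 1%N -> (forall n, A n -> A n.+1 -> A n.+2) -> forall n, A n.
Proof.
move=> A0 A1 AS n; suff: A n /\ A n.+1 by case.
by elim: n => // n [An An1]; split=> //; apply: AS.
Qed.

Section Recurrence.
Variables (F : fieldType) (g : nat -> F) (P : nat -> {poly F}).
Hypothesis ttrP : symmetric_ttr g P.
Implicit Types p q : {poly F}.

Lemma ttr_lead n : (P n)`_n = 1 /\ (forall i, (n < i)%N -> (P n)`_i = 0).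
Proof.
case: ttrP => P0 P1 PS; elim/nat_ind2: n => [||n [_ IHn] [IHn1 IHn1']].
- by rewrite P0 coef1; split=> // -[|i] //; rewrite coef1.
- by rewrite P1 coefX; split=> // -[|[|i]] //; rewrite coefX.
rewrite PS coefB coefXM coefZ /= IHn1 IHn ?mulr0 ?subr0 //; split=> // -[|i] //.
rewrite ltnS => lti; rewrite coefB coefXM coefZ /= IHn1' // IHn.
  by rewrite mulr0 subr0.
exact: leqW (ltnW lti).
Qed.

Lemma ttr_monic_size n : P n \is monic /\ size (P n) = n.+1.
Proof.
have [Pnn Pn0] := ttr_lead n.
have size_Pn : size (P n) = n.+1.
  apply/eqP; rewrite eqn_leq; apply/andP; split; first exact/leq_sizeP.
  rewrite ltnNge; apply/leq_sizeP => /(_ n (leqnn n)) /eqP.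
  by rewrite Pnn oner_eq0.
by rewrite monicE lead_coefE size_Pn /= Pnn.
Qed.

Lemma ttr_symmetric : symmetric_seq P.
Proof.
case: ttrP => P0 P1 PS; apply: nat_ind2 => [||n IHn IHn1].
- by rewrite P0 comp_polyC expr0 scale1r.
- by rewrite P1 comp_polyX expr1 scaleN1r.
rewrite PS comp_polyB comp_polyM comp_polyX comp_polyZ IHn IHn1 scalerBr.
congr (_ - _); last by rewrite !scalerA !exprS !mulN1r opprK mulrC.
by rewrite -scalerAr mulNr scalerN -scaleNr !exprS !mulN1r !opprK.
Qed.

(** Multiplication by x, read in the basis P with P_n written as x^n. *)
Definition jacobi (p : {poly F}) : {poly F} :=
  'X * p + \poly_(i < size p) (g i.+1 * p`_i.+1).

Lemma coef_jacobi p i :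
  (jacobi p)`_i = (if i is j.+1 then p`_j else 0) + g i.+1 * p`_i.+1.
Proof.
rewrite coefD coefXM coef_poly; congr (_ + _); first by case: i.
case: ltnP => // le_pi; rewrite nth_default ?mulr0 //.
exact: leq_trans le_pi (leqnSn i).
Qed.

Lemma jacobiP c p q : jacobi (c *: p + q) = c *: jacobi p + jacobi q.
Proof.
apply/polyP=> i; rewrite !(coefD, coefZ, coef_jacobi).
by case: i => [|i]; rewrite ?(coefD, coefZ); ring.
Qed.

(** The coordinates of p in the basis P, computed by substituting the Jacobi
    operator for x and applying the result to P_0. *)
Definition ttr_coord (p : {poly F}) : {poly F} :=
  \sum_(i < size p) p`_i *: iter i jacobi 1.

Lemma ttr_coord_wide n p : (size p <= n)%N ->
  ttr_coord p = \sum_(i < n) p`_i *: iter i jacobi 1.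
Proof.
move=> le_pn; rewrite /ttr_coord.
rewrite (big_ord_widen n (fun i => p`_i *: iter i jacobi 1)) // big_mkcond.
apply: eq_bigr => i _; case: ltnP => // le_pi.
by rewrite nth_default // scale0r.
Qed.

Lemma ttr_coordP c p q :
  ttr_coord (c *: p + q) = c *: ttr_coord p + ttr_coord q.
Proof.
pose n := maxn (size p) (size q).
have le_pn : (size p <= n)%N by exact: leq_maxl.
have le_qn : (size q <= n)%N by exact: leq_maxr.
rewrite (ttr_coord_wide le_pn) (ttr_coord_wide le_qn).
rewrite (@ttr_coord_wide n) => [|]; last first.
  rewrite (leq_trans (size_polyD _ _)) // geq_max le_qn andbT.
  exact: leq_trans (size_scale_leq _ _) _.
rewrite scaler_sumr -big_split; apply: eq_bigr => i _.
by rewrite coefD coefZ scalerDl scalerA.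
Qed.

Lemma ttr_coordXM p : ttr_coord ('X * p) = jacobi (ttr_coord p).
Proof.
rewrite (@ttr_coord_wide (size p).+1) => [|]; last first.
  by rewrite mulrC -(addr0 (p * 'X)) -polyC0 size_MXaddC; case: ifP.
rewrite big_ord_recl coefXM scale0r add0r /ttr_coord.
elim: (size p) => [|n IHn].
  rewrite !big_ord0; apply/polyP=> -[|i];
    by rewrite coef_jacobi !coef0 mulr0 addr0.
rewrite !big_ord_recr /= IHn coefXM /=.
by rewrite [in RHS]addrC jacobiP addrC.
Qed.

Lemma ttr_coord_basis n : ttr_coord (P n) = 'X^n.
Proof.
case: ttrP => P0 P1 PS.
have coord1 : ttr_coord 1 = 1.
  by rewrite /ttr_coord size_poly1 big_ord_recl big_ord0 coef1 scale1r addr0.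
have jacobi0 i :
    jacobi 'X^i = 'X^(i.+1) + g i *: (if i is j.+1 then 'X^j else 0).
  apply/polyP=> -[|k]; rewrite coef_jacobi coefD !coefXn coefZ.
    by case: i => [|[|i]]; rewrite ?coef0 ?coefXn ?mulr0 //= !add0r mulr1n.
  rewrite eqSS; case: i => [|i]; first by rewrite coef0 !mulr0.
  by rewrite !eqSS coefXn; have [<-|_] := eqVneq k.+1 i; rewrite ?mulr0.
elim/nat_ind2: n => [||n IHn IHn1]; first by rewrite P0.
  rewrite P1 -{1}['X]mulr1 ttr_coordXM coord1.
  by have := jacobi0 0%N; rewrite expr0 scaler0 addr0.
rewrite PS addrC -scaleNr ttr_coordP ttr_coordXM IHn IHn1 jacobi0.
by rewrite scaleNr addrC addrK.
Qed.

(** Orthogonality to P_0 = 1 forces u(P_n) = 0 for n > 0, so the functional can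
    only be the coordinate along P_0, up to a factor. *)
Definition ttr_functional (p : {poly F}) : F := (ttr_coord p)`_0.

Lemma ttr_functional_is_linear : scalar ttr_functional.
Proof. by move=> c p q; rewrite /ttr_functional ttr_coordP coefD coefZ. Qed.

HB.instance Definition _ :=
  GRing.isLinear.Build F {poly F} F *%R ttr_functional ttr_functional_is_linear.

(** For a functional vanishing on P_n for n > 0, moving a factor x from one
    polynomial to the other and applying the recurrence to both yields
    orthogonality, with the products g_1 ... g_n as squared norms. *)
Theorem favard : (forall n, g n.+1 != 0) -> is_MOPS P.
Proof.
move=> g_neq0; split; first exact: ttr_monic_size.
pose h n := \prod_(i < n) g i.+1.
have hS n : h n.+1 = h n * g n.+1 by rewrite /h big_ord_recr.
have h_neq0 n : h n != 0 by apply/prodf_neq0 => i _.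
pose u : {scalar {poly F}} := ttr_functional.
case: ttrP => P0 P1 PS.
have uP n : u (P n) = (n == 0%N)%:R.
  by rewrite /= /ttr_functional ttr_coord_basis coefXn eq_sym.
(* Moving x from P_{n+1} to P_m gives the case n+2 from the cases n and n+1. *)
have uPP n m : u (P n * P m) = (n == m)%:R * h n.
  elim/nat_ind2: n m => [m|m|n IHn IHn1 m].
  - by rewrite P0 mul1r uP eq_sym /h big_ord0 mulr1.
  - case: m => [|m]; first by rewrite P0 mulr1 uP mul0r.
    have -> : P 1%N * P m.+1 = P m.+2 + g m.+1 *: P m by rewrite P1 PS subrK.
    rewrite linearD linearZ /= !uP hS /h big_ord0 mul1r add0r.
    by case: m => [|m]; rewrite /= ?mulr1 ?mul1r ?mulr0 ?mul0r.
  have -> : P n.+2 * P m = P n.+1 * ('X * P m) - g n.+1 *: (P n * P m).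
    by rewrite PS mulrBl -scalerAl mulrCA mulrA.
  rewrite linearB linearZ /= IHn.
  case: m => [|m].
    rewrite P0 mulr1 -P1 IHn1 eqSS.
    by case: n {IHn IHn1} => [|n]; rewrite ?eqxx ?hS /=; ring.
  have -> : 'X * P m.+1 = P m.+2 + g m.+1 *: P m by rewrite PS subrK.
  rewrite mulrDr linearD -scalerAr linearZ /= !IHn1 !eqSS.
  have [<-|neq] := eqVneq n.+1 m.
    by rewrite (ltn_eqF (leqnSn n.+1)) !hS; ring.
  by have [<-|_] := eqVneq n m.+1; rewrite !hS /=; ring.
exists u; split=> [n m /eqP/negPf neq_nm|n]; first by rewrite uPP neq_nm mul0r.
by apply/eqP; rewrite expr2 uPP eqxx mul1r.
Qed.

End Recurrence.

Section Orthogonality.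
Variables (F : fieldType) (Q : nat -> {poly F}) (u : {scalar {poly F}}).
Hypothesis Q_monic : forall n, Q n \is monic /\ size (Q n) = n.+1.
Hypothesis Q_ortho : forall n m, n <> m -> u (Q n * Q m) = 0.
Hypothesis Q_norm : forall n, u (Q n ^+ 2) <> 0.

Lemma coef_monic_top n : (Q n)`_n = 1.
Proof. by have [/monicP <- szQ] := Q_monic n; rewrite lead_coefE szQ. Qed.

Lemma coef_monic_gt n i : (n < i)%N -> (Q n)`_i = 0.
Proof. by move=> lt_ni; rewrite nth_default // (Q_monic n).2. Qed.

Lemma size_sub_monic (p : {poly F}) k : (size p <= k.+1)%N ->
  (size (p - p`_k *: Q k)%R <= k)%N.
Proof.
move=> le_pk; apply/leq_sizeP => j.
rewrite leq_eqVlt coefB coefZ => /predU1P [<-|lt_kj].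
  by rewrite coef_monic_top mulr1 subrr.
by rewrite coef_monic_gt // nth_default ?mulr0 ?subr0 // (leq_trans le_pk).
Qed.

Lemma ortho_lower (p : {poly F}) n : (size p <= n)%N -> u (p * Q n) = 0.
Proof.
suff aux k : (k <= n)%N ->
    forall p : {poly F}, (size p <= k)%N -> u (p * Q n) = 0.
  by move=> le_pn; apply: (aux n).
elim: k => [|k IHk] le_kn q.
  by rewrite size_poly_leq0 => /eqP ->; rewrite mul0r linear0.
move=> le_qk; rewrite -(subrK (q`_k *: Q k) q) mulrDl linearD /=.
rewrite (IHk (ltnW le_kn) _ (size_sub_monic le_qk)) -scalerAl linearZ /=.
by rewrite Q_ortho ?mulr0 ?addr0 // => e; rewrite e ltnn in le_kn.
Qed.

(** The leading coefficient is killed by the product with Q_{k-1}, and so on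
    down to degree zero. *)
Lemma ortho_eq0 (p : {poly F}) k : (size p <= k)%N ->
  (forall j, (j < k)%N -> u (p * Q j) = 0) -> p = 0.
Proof.
elim: k => [|k IHk] le_pk ortho_p; first by apply/eqP; rewrite -size_poly_leq0.
have pk0 : p`_k = 0.
  have := ortho_p k (ltnSn k); rewrite -{1}(subrK (p`_k *: Q k) p).
  rewrite mulrDl linearD /=.
  rewrite ortho_lower ?size_sub_monic // add0r -scalerAl linearZ /= -expr2.
  by move/eqP; rewrite mulf_eq0 => /orP [/eqP //|/eqP /Q_norm].
have := size_sub_monic le_pk; rewrite pk0 scale0r subr0 => le_pk'.
by apply: IHk => // j lt_jk; apply: ortho_p; exact: leqW.
Qed.

End Orthogonality.

(** The remainder x Q_{n+1} - Q_{n+2} - g Q_n has degree at most n: degree n+2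
    cancels and degree n+1 has the wrong parity.  It is orthogonal to Q_j for
    j < n because x Q_j has degree below n+1, and to Q_n by the choice of g as a
    quotient of norms; so it vanishes. *)
Theorem symmetric_MOPS_ttr (F : fieldType) (Q : nat -> {poly F}) :
  2 != 0 :> F -> is_MOPS Q -> symmetric_seq Q ->
  exists2 g : nat -> F, forall n, g n.+1 != 0 & symmetric_ttr g Q.
Proof.
move=> two_neq0 [Qm [u [Qo Qn]]] Qs.
pose h n := u (Q n ^+ 2).
have Qlt i n : odd i != odd n -> (Q n)`_i = 0 by exact: coef_symmetric (Qs n).
have Qtop := coef_monic_top Qm; have Qgt := coef_monic_gt Qm.
exists (fun n => h n / h n.-1) => [n|].
  by apply: mulf_neq0; rewrite ?invr_eq0; apply/eqP; exact: Qn.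
split=> [||n].
- apply/polyP=> -[|i]; rewrite coef1 ?Qtop //; exact: Qgt.
- apply/polyP=> -[|[|i]]; rewrite coefX; first exact: Qlt.
    exact: Qtop.
  exact: Qgt.
rewrite /=; apply/eqP; rewrite -subr_eq0 -oppr_eq0; apply/eqP.
set D := - _.
have DE : D = 'X * Q n.+1 - Q n.+2 - (h n.+1 / h n) *: Q n by rewrite /D; ring.
apply: (ortho_eq0 Qm Qo Qn (k := n.+1)).
  apply/leq_sizeP => j; rewrite DE !coefB coefXM coefZ.
  case: j => [//|j]; rewrite ltnS /= leq_eqVlt => /predU1P [<-|].
    by rewrite !Qlt /= ?Qgt ?mulr0 ?subr0 //; case: (odd n).
  rewrite leq_eqVlt => /predU1P [<-|lt_j].
    by rewrite !Qtop Qgt // mulr0 subr0 subrr.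
  by rewrite !Qgt ?mulr0 ?subr0 // ltnW // ltnW.
move=> j; rewrite ltnS leq_eqVlt => le_jn.
rewrite DE !mulrBl !linearB /= -scalerAl linearZ /=.
have le_jn' : (j <= n)%N by rewrite leq_eqVlt.
rewrite [u (Q n.+2 * _)]Qo => [|e]; last by rewrite -e !ltnNge leqnSn in le_jn'.
rewrite subr0 -mulrA mulrCA mulrC.
have szX : (size ('X * Q j)%R <= j.+2)%N.
  by rewrite (leq_trans (size_polyMleq _ _)) // size_polyX (Qm j).2.
case/predU1P: le_jn => [ejn|lt_jn].
  rewrite {j le_jn'}ejn in szX *.
  have szr := size_sub_monic Qm szX.
  rewrite -(subrK (('X * Q n)`_n.+1 *: Q n.+1) ('X * Q n)) mulrDl linearD /=.
  rewrite (ortho_lower Qm Qo szr) add0r coefXM /= Qtop scale1r -!expr2.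
  rewrite -[u (Q n.+1 ^+ 2)]/(h n.+1) -[u (Q n ^+ 2)]/(h n) divfK ?subrr //.
  exact/eqP/Qn.
rewrite (ortho_lower Qm Qo) ?Qo ?mulr0 ?subrr //.
  by move=> e; rewrite e ltnn in lt_jn.
exact: leq_trans szX _.
Qed.

(** * The connection between P and its Dunkl derivatives *)

Section Connection.
Variables (F : fieldType) (mu : F) (gamma g : nat -> F) (P Q : nat -> {poly F}).
Hypothesis two_neq0 : 2 != 0 :> F.
Hypothesis xi_neq0 : forall n : nat, dunkl_xi mu n != 0.
Hypothesis ttrP : symmetric_ttr gamma P.
Hypothesis ttrQ : symmetric_ttr g Q.

Lemma ttr_dunkl_mulX (h : nat -> F) (S : nat -> {poly F}) n :
  symmetric_ttr h S ->
  dunkl mu ('X * S n) = 'X * dunkl mu (S n) + dunkl_xi mu n *: S n.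
Proof.
by move=> ttrS; apply: dunkl_mulX => //; apply: ttr_symmetric ttrS n.
Qed.

Lemma ttr_free n (c d : F) : c *: Q n.+2 + d *: Q n = 0 -> c = 0 /\ d = 0.
Proof.
move=> e; have /polyP/(_ n.+2) := e; have [Q2 _] := ttr_lead ttrQ n.+2.
have [Q0 Q0gt] := ttr_lead ttrQ n.
rewrite coefD !coefZ Q2 Q0gt // mulr1 mulr0 addr0 coef0 => c0; split=> //.
by move/polyP/(_ n): e; rewrite coefD !coefZ Q0 c0 mul0r add0r mulr1 coef0.
Qed.

(** Substituting the connection into the recurrence of P_{n+4} and expanding in
    the basis Q, the coefficients of Q_{n+2} and Q_n are the two relations; the
    convention s_0 = 0 covers the short initial cases. *)
Lemma connection_ttr (s : nat -> F) : s 0%N = 0 ->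
  (forall n, P n.+2 = Q n.+2 + s n.+1 *: Q n) <->
  (forall n, s n.+1 = g n.+1 + s n - gamma n.+1) /\
  (forall n, s n.+2 * g n.+1 = gamma n.+3 * s n.+1).
Proof.
case: ttrP ttrQ => P0 P1 PS [Q0 Q1 QS] s0.
have XQ n : 'X * Q n.+1 = Q n.+2 + g n.+1 *: Q n by rewrite QS subrK.
have XX : 'X * 'X = Q 2%N + (g 1%N)%:P by rewrite QS Q1 Q0 alg_polyC subrK.
split=> [conn|[s_rec s_mul]].
  have coefs n : s n.+3 = g n.+3 + s n.+2 - gamma n.+3 /\
                 s n.+2 * g n.+1 = gamma n.+3 * s n.+1.
    have := @ttr_free n (g n.+3 + s n.+2 - gamma n.+3 - s n.+3)
              (s n.+2 * g n.+1 - gamma n.+3 * s n.+1).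
    have := conn n.+2; rewrite PS !conn mulrDr XQ -scalerAr XQ => /eqP.
    rewrite -subr_eq0 => /eqP <-.
    case=> [|/eqP + /eqP]; first by rewrite -!mul_polyC; ring.
    by rewrite !subr_eq0 => /eqP <- /eqP.
  split=> [n|n]; last by have [] := coefs n.
  case: n => [|[|n]]; last by have [] := coefs n.
    apply: (@polyC_inj F); have := conn 0%N.
    rewrite PS P1 P0 Q0 XX !alg_polyC s0 addr0 polyCB -addrA.
    by move/addrI->.
  have := conn 1%N; rewrite PS conn P1 Q0 Q1 alg_polyC mulrDr XQ Q1.
  rewrite [ 'X * _%:P ]mulrC mul_polyC -!addrA => /addrI.
  rewrite -scaleNr -!scalerDl addrA => /polyP/(_ 1%N).
  by rewrite !coefZ coefX !mulr1.
suff conn n : P n.+2 = Q n.+2 + s n.+1 *: Q n /\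
              P n.+3 = Q n.+3 + s n.+2 *: Q n.+1.
  by move=> n; case: (conn n).
have conn0 : P 2%N = Q 2%N + s 1%N *: Q 0%N.
  by rewrite PS P1 P0 Q0 XX s_rec s0 !alg_polyC polyCB addr0 addrA.
elim: n => [|n [IH0 IH1]]; split=> //.
  rewrite PS conn0 P1 Q0 mulrDr XQ Q1 (s_rec 1%N) -!mul_polyC; ring.
rewrite PS IH0 IH1 mulrDr XQ -scalerAr XQ (s_rec n.+2) scalerDr scalerA s_mul.
by rewrite -!mul_polyC; ring.
Qed.

(** Applying the operator to the recurrence of P_{n+2} leaves a multiple
    xi_{n+1} of P_{n+1}, and everything else is in the span of the Q_k.  In the
    hypothesis on s, xi_n stands for the equal number xi_{n+2}. *)
Lemma dunkl_deriv_connection (s : nat -> F) :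
  (forall n : nat, dunkl_xi mu n * s n.+1 =
     gamma n.+2 * dunkl_mu mu n.+1 - dunkl_mu mu n.+2 * g n.+1) ->
  (forall n : nat, dunkl mu (P n.+1) = dunkl_mu mu n.+1 *: Q n) <->
  (forall n, P n.+2 = Q n.+2 + s n.+1 *: Q n).
Proof.
case: (ttrP) (ttrQ) => P0 P1 PS [Q0 Q1 QS] sE.
have XQ n : 'X * Q n.+1 = Q n.+2 + g n.+1 *: Q n by rewrite QS subrK.
have TPS n : dunkl mu (P n.+2) =
  'X * dunkl mu (P n.+1) + dunkl_xi mu n.+1 *: P n.+1
  - gamma n.+1 *: dunkl mu (P n).
  by rewrite PS dunklB dunklZ (ttr_dunkl_mulX n.+1 ttrP).
have xiSS (n : nat) : dunkl_xi mu n.+2 = dunkl_xi mu n.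
  by rewrite !dunkl_xiSn; ring.
split=> [TP n|conn].
  apply: (scalerI (xi_neq0 n)); rewrite scalerDr scalerA sE.
  have := TPS n.+1; rewrite !TP -!scalerAr XQ => /eqP.
  rewrite (dunkl_muSn mu n.+2) xiSS -subr_eq0 => /eqP e.
  apply/eqP; rewrite -subr_eq0 -oppr_eq0 -{}e; apply/eqP.
  by rewrite -!mul_polyC; ring.
elim/nat_ind2 => [||n TP1 TP2]; first by rewrite P1 Q0 alg_polyC dunklX.
  rewrite TPS P1 P0 Q1 dunklX dunklC scaler0 subr0.
  rewrite (dunkl_muSn mu 1) [RHS]scalerDl.
  by rewrite mulrC mul_polyC.
rewrite TPS TP1 TP2 conn -scalerAr XQ (dunkl_muSn mu n.+2) xiSS.
rewrite [dunkl_xi mu n *: _]scalerDr scalerA sE.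
by rewrite -!mul_polyC; ring.
Qed.

End Connection.

(** * The differential-difference equation *)

Section Equation.
Variables (F : fieldType) (mu : F) (gamma : nat -> F) (P : nat -> {poly F}).
Hypothesis mu_neq0 : forall n : nat, dunkl_mu mu n.+1 != 0.
Hypothesis xi_neq0 : forall n : nat, dunkl_xi mu n != 0.
Hypothesis ttrP : symmetric_ttr gamma P.
Hypothesis gamma_neq0 : forall n, gamma n.+1 != 0.

Local Notation m n := (dunkl_mu mu (Posz n)).
Local Notation x n := (dunkl_xi mu (Posz n)).

Let two_neq0 : 2 != 0 :> F.
Proof. by rewrite -(dunkl_mu2 mu); exact: mu_neq0. Qed.

Definition dunkl_equation (theta : int -> F) (n : nat) : Prop :=
  (coef_a theta n *: 'X^2 - (coef_b mu gamma theta n)%:P)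
    * dunkl mu (dunkl mu (P n))
  - coef_c mu theta n *: ('X * dunkl mu (P n))
  - coef_d mu theta n *: P n = 0.

(** Everything at the index n+1 is expressed by mu_n, xi_n and theta_n, using
    mu_{n+2} = mu_n + 2, xi_{n+1} = 2 - xi_n and mu_{n-1} = mu_n - 2 + xi_n; the
    identities below are then rational in these three unknowns and gamma. *)
Lemma coefs_succ (theta : int -> F) (n : nat) :
  [/\ coef_a theta n.+1 = theta n - 1,
      coef_b mu gamma theta n.+1 =
        ((m n + 2) * theta n - (m n + x n)) * (m n * theta n - (m n - 2 + x n))
        * (gamma n.+1 / ((2 - x n) * (m n + x n))),
      coef_c mu theta n.+1 = (m n - 2 + x n) * theta n - m n &
      coef_d mu theta n.+1 = (2 - x n) * (m n + x n) * theta n].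
Proof.
have e1 : n.+1%:Z - 1 = n by rewrite -addn1 PoszD addrK.
have e2 : n.+1%:Z - 2 = n%:Z - 1 by rewrite -addn1 PoszD -addrA.
have e3 : n.+1%:Z + 1 = n.+2 by rewrite -PoszD addn1.
rewrite /coef_a /coef_b /coef_c /coef_d /= e1 e2 e3.
rewrite dunkl_mu_pred !dunkl_muSn dunkl_xiSn; split=> //.
by congr (_ * _ * _); ring.
Qed.

Lemma dunkl_equation0 (theta : int -> F) :
  theta (-1) = 0 -> dunkl_equation theta 0.
Proof.
case: ttrP => P0 _ _ th; have T1 : dunkl mu 1 = 0 by rewrite -polyC1 dunklC.
have T0 : dunkl mu 0 = 0 by rewrite -polyC0 dunklC.
rewrite /dunkl_equation P0 T1 T0 /coef_d sub0r th.
by rewrite !mulr0 !scaler0 scale0r !subr0.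
Qed.

Lemma dunkl_equation1 (theta : int -> F) :
  theta 0 = 1 -> dunkl_equation theta 1.
Proof.
case: ttrP => _ P1 _ th; have [_ _ cE dE] := coefs_succ theta 0.
rewrite /dunkl_equation cE dE th P1 dunklX dunklC dunkl_mu0 dunkl_mu1.
by rewrite mulr0 sub0r -!mul_polyC; ring.
Qed.

(** The coefficient s_k of the connection P_{k+1} = Q_{k+1} + s_k Q_{k-1}; the
    denominator 2 - xi_k is xi_{k+1}. *)
Definition theta_conn (t : nat -> F) (k : nat) : F :=
  gamma k.+1 * m k * (1 - t k) / (2 - x k).

(** The coefficient g_k of the recurrence of Q. *)
Definition theta_coef (t : nat -> F) (k : nat) : F :=
  m k / m k.+1 * t k * gamma k.+1.

Lemma x_succ_neq0 n : 2 - x n != 0.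
Proof. by rewrite -dunkl_xiSn. Qed.

Lemma theta_conn_coef (t : nat -> F) n :
  x n * theta_conn t n.+1 = gamma n.+2 * m n.+1 - m n.+2 * theta_coef t n.+1.
Proof.
have h1 := mu_neq0 n.+1; have h2 := xi_neq0 n.
rewrite /theta_conn /theta_coef (dunkl_xiSn _ n) subKr.
by field; rewrite h1 h2.
Qed.

(** The difference of the two sides of the first equation is a nonzero multiple
    of that of the second. *)
Lemma theta_conn_riccati (t : nat -> F) n : t n.+1 != 0 ->
  (theta_conn t n.+2 * theta_coef t n.+1 = gamma n.+3 * theta_conn t n.+1) <->
  (x n.+2 * t n.+2 + x n.+1 * (t n.+1)^-1 = 2).
Proof.
move=> t_neq0; have h := xi_neq0 n.+1; have h' := x_succ_neq0 n.+1.
have m1 := mu_neq0 n; have m2 := mu_neq0 n.+1.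
have g2 := gamma_neq0 n.+1; have g3 := gamma_neq0 n.+2.
set c := gamma n.+3 * gamma n.+2 * m n.+1 * t n.+1 / (x n.+1 * (2 - x n.+1)).
have c_neq0 : c != 0 by rewrite !(mulf_neq0, invr_eq0).
have e : theta_conn t n.+2 * theta_coef t n.+1 - gamma n.+3 * theta_conn t n.+1
     = c * (2 - ((2 - x n.+1) * t n.+2 + x n.+1 * (t n.+1)^-1)).
  rewrite /c /theta_conn /theta_coef (dunkl_xiSn _ n.+1) subKr; field.
  by rewrite t_neq0 h h' m2.
rewrite /theta_conn /theta_coef (dunkl_xiSn _ n.+1) in e *.
split=> /eqP; rewrite -subr_eq0; last first.
  rewrite -oppr_eq0 opprB => /eqP e0; apply/eqP.
  by rewrite -subr_eq0 e e0 mulr0.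
by rewrite e mulf_eq0 (negbTE c_neq0) /= subr_eq0 eq_sym => /eqP.
Qed.

Section Forward.
Variables (theta : int -> F) (Q : nat -> {poly F}).
Let t (n : nat) : F := theta n.
Hypothesis theta_neq0 : forall n, t n.+1 != 0.
Hypothesis ttrQ : symmetric_ttr (theta_coef t) Q.
Hypothesis TP : forall n : nat, dunkl mu (P n.+1) = m n.+1 *: Q n.
Hypothesis conn : forall n, P n.+2 = Q n.+2 + theta_conn t n.+1 *: Q n.
Hypothesis ric : riccati mu theta.

(** The polynomials Q_n and T Q_n are eliminated between the connection, in the
    form P_{n+2} = x Q_{n+1} + e Q_n, and the two lowering relations. *)
Lemma dunkl_equation_forward n : dunkl_equation theta n.+2.
Proof.
case: (ttrQ) (ttrP) => Q0 Q1 QS [P0 P1 PS].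
have m1 := mu_neq0 n; have m2 := mu_neq0 n.+1; have x1 := x_succ_neq0 n.+1.
rewrite dunkl_muSn in m2.
(* The ratio s_{n+1} / gamma_{n+2}, which the Riccati equation makes equal to
   s_n / g_n when n > 0. *)
pose r := m n.+1 * (1 - t n.+1) / (2 - x n.+1).
pose e := theta_conn t n.+1 - theta_coef t n.+1.
have connE : theta_conn t n.+1 = gamma n.+2 * r by rewrite /theta_conn /r; ring.
have xi_r : (2 - x n.+1) * r = m n.+1 * (1 - t n.+1) by rewrite /r mulrC divfK.
have TQX := ttr_dunkl_mulX mu two_neq0 _ ttrQ.
have PE : P n.+2 = 'X * Q n.+1 + e *: Q n.
  by rewrite conn QS /e -!mul_polyC; ring.
(* The image of PE by the operator. *)
have lower1 : m n.+1 *: Q n.+1 = 'X * dunkl mu (Q n.+1) + e *: dunkl mu (Q n).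
  have := TP n.+1; rewrite PE dunklD dunklZ TQX (dunkl_muSn _ n.+1) => /eqP.
  rewrite -subr_eq0 => /eqP E; apply/eqP; rewrite -subr_eq0 -oppr_eq0 -E.
  by apply/eqP; rewrite -!mul_polyC; ring.
(* For n = k+1, the image of the connection of P_{k+2} minus r times that of the
   recurrence of Q_{k+2}: the Riccati equation says that T Q_k cancels. *)
have lower2 : (m n.+1 * t n.+1) *: Q n =
    (1 - r) *: dunkl mu (Q n.+1) + r *: ('X * dunkl mu (Q n)).
  have -> : m n.+1 * t n.+1 = m n.+1 - (2 - x n.+1) * r by rewrite xi_r; ring.
  rewrite dunkl_xiSn subKr.
  case: n @r @e m1 m2 x1 connE xi_r PE lower1
    => [|k] r e m1 m2 x1 connE xi_r PE lower1.
    rewrite Q0 Q1 -polyC1 dunklX dunklC mulr0 scaler0 addr0 dunkl_mu1.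
    by rewrite -!mul_polyC; ring.
  have rg : r * theta_coef t k.+1 = theta_conn t k.+1.
    have := (@theta_conn_riccati t k (theta_neq0 k)).2 (ric (ltn0Sn k)).
    by rewrite connE -mulrA => /(mulfI (gamma_neq0 _)).
  have E1 : dunkl mu (Q k.+2) + theta_conn t k.+1 *: dunkl mu (Q k)
      - m k.+2 *: Q k.+1 = 0.
    by rewrite -TP conn dunklD dunklZ subrr.
  have E2 : 'X * dunkl mu (Q k.+1) + x k.+1 *: Q k.+1
      - theta_coef t k.+1 *: dunkl mu (Q k) - dunkl mu (Q k.+2) = 0.
    by rewrite [in dunkl mu (Q k.+2)]QS dunklB dunklZ TQX subrr.
  apply/eqP; rewrite eq_sym -subr_eq0; apply/eqP.
  transitivity ((0 : {poly F}) + r *: 0); last by rewrite scaler0 addr0.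
  by rewrite -{1}E1 -E2 -rg -!mul_polyC; ring.
rewrite /dunkl_equation; have [-> -> -> ->] := coefs_succ theta n.+1.
rewrite TP dunklZ (dunkl_muSn _ n.+1).
(* e times lower2, where PE and lower1 replace e Q_n and e T Q_n. *)
pose K := e *: ((m n.+1 * t n.+1) *: Q n -
   ((1 - r) *: dunkl mu (Q n.+1) + r *: ('X * dunkl mu (Q n)))).
have K0 : K = 0 by rewrite /K lower2 subrr scaler0.
(* Chosen so that P_{n+2} gets the coefficient - d_{n+2}. *)
set c := - ((m n.+1 + x n.+1) * (2 - x n.+1) / m n.+1).
transitivity (c *: K); last by rewrite K0 scaler0.
have eQ : e *: Q n = P n.+2 - 'X * Q n.+1 by rewrite PE addrC addKr.
have eT : e *: dunkl mu (Q n) = m n.+1 *: Q n.+1 - 'X * dunkl mu (Q n.+1).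
  by rewrite lower1 addrC addKr.
have -> : K = (m n.+1 * t n.+1) *: (P n.+2 - 'X * Q n.+1)
    - (1 - r) *: (e *: dunkl mu (Q n.+1))
    - r *: ('X * (m n.+1 *: Q n.+1 - 'X * dunkl mu (Q n.+1))).
  by rewrite -eQ -eT /K -!mul_polyC; ring.
have XXT : 'X * ('X * dunkl mu (Q n.+1)) = 'X^2 * dunkl mu (Q n.+1).
  by rewrite mulrA.
rewrite mulrBl -scalerAl mul_polyC !scalerBr -!scalerAr !mulrBr XXT -!scalerAr.
apply/polyP=> i; rewrite !(coefB, coefZ) /c /r /e /theta_conn /theta_coef.
rewrite (dunkl_muSn _ n.+1) -/(t n.+1).
move: (dunkl mu _)`_i ('X^2 * _)`_i ('X * _)`_i (P _)`_i => U XXU XQ Pi.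
by field; rewrite m1 m2 x1.
Qed.

End Forward.

(** The value theta_n = mu_{n-1} / mu_n propagates through the Riccati equation
    as theta_{n+k} = mu_{n-k-1} / mu_{n-k}, which vanishes at k = n - 1.  Only
    the parity links the index of theta to that of mu, whence the induction on j
    for all n. *)
Lemma riccati_descent (theta : int -> F) :
  (forall n : nat, (1 <= n)%N -> theta n <> 0) -> riccati mu theta ->
  forall j n : nat, odd n.+1 = odd j.+1 -> m j.+1 * theta n.+1 != m j.
Proof.
move=> th_neq0 ric; elim=> [|j IHj] n par.
  by rewrite dunkl_mu0 mulf_neq0 //; apply/eqP/th_neq0.
apply/eqP => e; have := IHj n.+1; rewrite /= in par *; rewrite par negbK.
case/(_ erefl)/negP; apply/eqP.
have := ric n.+1 isT; rewrite (dunkl_xiSn _ n.+1) (dunkl_xi_odd _ n.+1) /= par.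
have -> : dunkl_xi mu (~~ ~~ odd j) = x j by rewrite negbK -dunkl_xi_odd.
have th0 := mu_neq0 j.
have -> : (theta n.+1)^-1 = (m j + 2) / m j.+1.
  have tn0 : theta n.+1 != 0 by apply/eqP/th_neq0.
  apply: (mulfI tn0); rewrite divff // mulrA; apply: (mulIf th0).
  by rewrite mul1r divfK // -e dunkl_muSn dunkl_muSn dunkl_xiSn; ring.
move=> r; apply: (mulfI (x_succ_neq0 j)).
rewrite mulrCA (_ : (2 - x j) * _ = 2 - x j * ((m j + 2) / m j.+1)); last first.
  by apply/eqP; rewrite eq_sym subr_eq r.
move: th0; rewrite dunkl_muSn => th0; by field.
Qed.

Lemma riccati_neq (theta : int -> F) :
  (forall n : nat, (1 <= n)%N -> theta n <> 0) -> riccati mu theta ->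
  forall n : nat, m n.+1 * theta n.+1 - (m n.+1 - 2 + x n.+1) != 0.
Proof.
move=> th_neq0 ric n; have := riccati_descent th_neq0 ric (erefl (odd n.+1)).
have -> : m n.+1 - 2 + x n.+1 = m n by rewrite dunkl_muSn dunkl_xiSn; ring.
by rewrite subr_eq0.
Qed.

Section Backward.
Variable theta : int -> F.
Let t (n : nat) : F := theta n.
Hypothesis theta_neq0 : forall n : nat, (1 <= n)%N -> theta n <> 0.
Hypothesis ric : riccati mu theta.
Hypothesis eqn : forall n, dunkl_equation theta n.

(** This is the coefficient of x^n in the equation of P_{n+2}, after cancelling
    the factor that riccati_neq shows to be nonzero. *)
Lemma dunkl_equation_subleading n :
  2 * (P n.+2)`_n = m n.+2 * (theta_conn t n.+1 - theta_coef t n.+1).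
Proof.
have [Ptop _] := ttr_lead ttrP n.+2.
have /polyP/(_ n) := eqn n.+2; rewrite /dunkl_equation.
have [-> -> -> ->] := coefs_succ theta n.+1.
rewrite mulrBl -scalerAl mul_polyC !coefB !coefZ coef_XXMdunkl2 coef_XMdunkl.
rewrite !coef_dunkl Ptop coef0 dunkl_mu_pred.
have x1 := x_succ_neq0 n.+1; have m2 := mu_neq0 n.+1; have m1 := mu_neq0 n.
have xE : x n = 2 - x n.+1 by rewrite dunkl_xiSn subKr.
have mE : m n = m n.+1 - 2 + x n.+1 by rewrite dunkl_muSn dunkl_xiSn; ring.
have D_neq0 := riccati_neq theta_neq0 ric n; set D := (X in X != 0) in D_neq0.
rewrite mE xE (dunkl_muSn _ n.+1) in m2 * => E; apply: (mulfI D_neq0).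
apply/eqP; rewrite -subr_eq0 -oppr_eq0 -[X in _ == X]E.
rewrite /theta_conn /theta_coef /D (dunkl_muSn _ n.+1) -/(t n.+1).
by apply/eqP; field; rewrite m2 x1.
Qed.

(** The recurrence of P gives -gamma_{n+2} as the difference of the subleading
    coefficients of P_{n+3} and P_{n+2}. *)
Lemma theta_conn_rec n :
  theta_conn t n.+1 = theta_coef t n.+1 + theta_conn t n - gamma n.+1.
Proof.
have m2 := mu_neq0 n.+1.
suff: m n.+2 * (theta_conn t n - gamma n.+1) = 2 * (P n.+2)`_n.
  rewrite dunkl_equation_subleading => /(mulfI m2) e.
  by rewrite -addrA e addrC subrK.
case: ttrP => P0 P1 PS; case: n m2 => [|k] m2.
  rewrite PS P0 P1 coefB coefXM coefZ coef1 /= /theta_conn dunkl_mu0 dunkl_mu2.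
  by ring.
rewrite PS coefB coefXM coefZ (ttr_lead ttrP k.+1).1 /= [in RHS]mulrBr.
rewrite dunkl_equation_subleading /theta_conn /theta_coef.
rewrite (dunkl_muSn _ k.+2) (dunkl_xiSn _ k.+1).
have x1 := x_succ_neq0 k.+1; have m1 := mu_neq0 k.+1.
by rewrite (dunkl_muSn _ k.+1) in m1 *; field; rewrite m1 x1.
Qed.

End Backward.

(** From Q, theta_n is read off as mu_{n+1} g_n / (mu_n gamma_{n+1}); from
    theta, Q is recovered as the sequence generated by [theta_coef]. *)
Theorem dunkl_classical_iff :
  dunkl_classical mu P <->
  exists theta : int -> F,
    [/\ theta 0 = 1, theta (-1) = 0,
        (forall n : nat, (1 <= n)%N -> theta n <> 0),
        riccati mu theta & forall n, dunkl_equation theta n].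
Proof.
split=> [[_ MOPS_Q]|[theta [th0 thN1 th_neq0 ric eqn]]].
  set Q := dunkl_deriv_seq mu P in MOPS_Q.
  have TP (n : nat) : dunkl mu (P n.+1) = m n.+1 *: Q n.
    by rewrite /Q /dunkl_deriv_seq scalerA divff // scale1r.
  have symQ : symmetric_seq Q.
    move=> n; rewrite comp_polyZ (dunkl_symmetric mu (ttr_symmetric ttrP n.+1)).
    by rewrite scalerA mulrC -scalerA.
  have [g g_neq0 ttrQ] := symmetric_MOPS_ttr two_neq0 MOPS_Q symQ.
  pose theta (n : int) : F := match n with
    | Posz 0 => 1
    | Posz k.+1 => m k.+2 * g k.+1 / (m k.+1 * gamma k.+2)
    | Negz _ => 0 end.
  pose t (n : nat) := theta n.
  have th_neq0 n : t n.+1 != 0 by rewrite !(mulf_neq0, invr_eq0).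
  have gE n : g n.+1 = theta_coef t n.+1.
    rewrite /theta_coef /t /=.
    have m1 := mu_neq0 n; have m2 := mu_neq0 n.+1; have g2 := gamma_neq0 n.+1.
    by field; rewrite m1 m2 g2.
  have {}ttrQ : symmetric_ttr (theta_coef t) Q.
    by case: ttrQ => Q0 Q1 QS; split=> // n; rewrite QS gE.
  have conn := (dunkl_deriv_connection two_neq0 xi_neq0 ttrP ttrQ
                  (theta_conn_coef t)).1 TP.
  have conn0 : theta_conn t 0 = 0 by rewrite /theta_conn dunkl_mu0 mulr0 !mul0r.
  have [_ s_mul] := (connection_ttr ttrP ttrQ conn0).1 conn.
  have ric : riccati mu theta.
    by move=> [|n] // _; exact: ((theta_conn_riccati (th_neq0 n)).1 (s_mul n)).
  exists theta; split=> // [[|n] // _|[|[|n]]]; first exact/eqP/th_neq0.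
  - exact: dunkl_equation0.
  - exact: dunkl_equation1.
  - exact: (dunkl_equation_forward th_neq0 ttrQ TP conn ric).
pose t (n : nat) := theta n.
have t_neq0 n : t n.+1 != 0 by apply/eqP/th_neq0.
have ttrQ := symop_ttr (theta_coef t).
have conn0 : theta_conn t 0 = 0 by rewrite /theta_conn dunkl_mu0 mulr0 !mul0r.
have conn := (connection_ttr ttrP ttrQ conn0).2
  (conj (theta_conn_rec th_neq0 ric eqn)
        (fun n => (theta_conn_riccati (t_neq0 n)).2 (ric n.+1 isT))).
have TP := (dunkl_deriv_connection two_neq0 xi_neq0 ttrP ttrQ
              (theta_conn_coef t)).2 conn.
have QE n : dunkl_deriv_seq mu P n = symop (theta_coef t) n.
  by rewrite /dunkl_deriv_seq TP scalerA mulVf // scale1r.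
split; first exact: favard ttrP gamma_neq0.
apply: (@favard _ (theta_coef t)) => [|n]; last by rewrite !mulf_neq0 ?invr_eq0.
by case: ttrQ => Q0 Q1 QS; split=> [||n]; rewrite !QE.
Qed.

End Equation.

(** * The complex case *)

(** mu_{n+1} is n + 1 for odd n, and n + 1 + 2 mu for even n. *)
Lemma dunkl_mu_nat_neq0 (R : realType) (mu : R) :
  (forall n : nat, mu <> - n%:R - 1 / 2) ->
  forall n : nat, dunkl_mu mu%:C n.+1 != 0.
Proof.
move=> hmu n; rewrite /dunkl_mu -exprnP -signr_odd -pmulrn.
have [odd_n|even_n] := boolP (odd n.+1); last first.
  by rewrite expr0 subrr mulr0 addr0 pnatr_eq0.
have nE : n.+1 = (n./2).*2.+1.
  by rewrite -[n in LHS]odd_double_half; move: odd_n => /= /negbTE ->.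
rewrite nE expr1 opprK; apply/eqP => e; apply: (hmu n./2).
have {}e : (n./2.*2.+1%:R + mu * (1 + 1))%:C = 0.
  by rewrite rmorphD rmorphM rmorphD rmorph1 rmorph_nat.
move/eqP: e; rewrite fmorph_eq0 -muln2 -addn1 natrD natrM => /eqP e.
by lra.
Qed.

Lemma dunkl_xi_nat_neq0 (R : realType) (mu : R) :
  (forall n : nat, mu <> - n%:R - 1 / 2) -> mu <> 1 / 2 ->
  forall n : nat, dunkl_xi mu%:C n != 0.
Proof.
move=> hmu hmu' n; rewrite dunkl_xi_odd; case: (odd n); last first.
  by rewrite -dunkl_mu1 dunkl_mu_nat_neq0.
rewrite /dunkl_xi expr1z mulrN1; apply/eqP => e; apply: hmu'.
have {}e : (1 - 2 * mu)%:C = 0 by rewrite rmorphB rmorphM rmorph1 rmorph_nat.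
by move/eqP: e; rewrite fmorph_eq0 => /eqP e; lra.
Qed.

Theorem theorem2p2 (R : realType) (mu : R)
    (hmu : forall n : nat, mu <> - n%:R - 1 / 2) (hmu' : mu <> 1 / 2)
    (P : nat -> {poly R[i]}) (gamma : nat -> R[i])
    (hP : is_MOPS P) (hsym : symmetric_seq P)
    (hP0 : P 0%N = 1) (hP1 : P 1%N = 'X)
    (hrec : forall n : nat, P n.+2 = 'X * P n.+1 - gamma n.+1 *: P n)
    (hgamma : forall n : nat, gamma n.+1 <> 0) :
  dunkl_classical mu%:C P <->
  exists theta : int -> R[i],
    [/\ theta 0 = 1, theta (-1) = 0,
        (forall n : nat, (1 <= n)%N -> theta n <> 0),
        riccati mu%:C theta &
        forall n : nat,
          (coef_a theta n *: 'X^2 - (coef_b mu%:C gamma theta n)%:P)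
            * dunkl mu%:C (dunkl mu%:C (P n))
          - coef_c mu%:C theta n *: ('X * dunkl mu%:C (P n))
          - coef_d mu%:C theta n *: P n = 0].
Proof.
apply: (dunkl_classical_iff (gamma := gamma)) => //.
- exact: dunkl_mu_nat_neq0.
- exact: dunkl_xi_nat_neq0.
- by move=> n; apply/eqP.
Qed.
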